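(* Let $m,n$ be positive integers, $I=\{1,\dots,m\}$, $J=\{1,\dots,n\}$, let $A=(a_{ij})$ be an $m\times n$ matrix with entries in $[0,1]$ and let $b=(b_i)\in[0,1]^m$. Then $\underline{S}(A,b)\subseteq\{\underline{X}(e): e\in\bar{E}\}\subseteq\{\underline{X}(e): e\in E\}$.
   Context: $T_L(x,y)=\max\{x+y-1,0\}$ is the Lukasiewicz t-norm. The feasible set is $S(A,b)=\{x\in[0,1]^n:\ \max_{j=1}^n T_L(a_{ij},x_j)=b_i \text{ for all } i\in I\}$, and $\underline{S}(A,b)$ denotes the set of all minimal solutions, i.e. the minimal elements of $S(A,b)$ with respect to the componentwise order. For $i\in I$ let $J_i=\{j\in J: a_{ij}\ge b_i\}$. $E$ is the set of all functions $e:I\to\bigcup_{i\in I}J_i$ with $e(i)\in J_i$ for every $i\in I$. The vector $\bar X\in[0,1]^n$ is the componentwise minimum $\bar{X}=\min_{i\in I}\hat{x}_i$, where $(\hat{x}_i)_j=b_i+1-a_{ij}$ if $j\in J_i$, and $(\hat{x}_i)_j=1$ if $j\notin J_i$. For $i\in I$ let $\bar J_i=\{j\in J_i: T_L(a_{ij},\bar X_j)=b_i\}$. $\bar E$ is the set of all functions $e:I\to\bigcup_{i\in I}\bar J_i$ with $e(i)\in\bar J_i$ for every $i\in I$. For $i\in I$ and $j\in J_i$, the vector $\check{x}_i(j)$ is defined by $\check{x}_i(j)_k=b_i+1-a_{ij}$ if $b_i\ne 0$ and $k=j$, and $\check{x}_i(j)_k=0$ otherwise ($k\in J$). For $e\in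 E$, $\underline{X}(e)\in[0,1]^n$ is defined by $\underline{X}(e)_j=\max_{i\in I}\check{x}_i(e(i))_j$ for $j\in J$. *)

(* Defs.v *)
From HB Require Import structures.
From mathcomp Require Import all_boot all_order all_algebra.
From mathcomp Require Import classical_sets.

Set Implicit Arguments.
Unset Strict Implicit.
Unset Printing Implicit Defensive.

Import Order.TTheory GRing.Theory Num.Theory.

Local Open Scope ring_scope.

(* The real numbers are generalized to an arbitrary totally ordered field R.
   I = 'I_m, J = 'I_n, and elements of R^n are column vectors, x_j being
   [x j 0]. *)

Section LukasiewiczSystem.

Variables (R : realFieldType) (m n : nat) (A : 'M[R]_(m, n)) (b : 'cV[R]_m).

Definition TL (x y : R) : R := Num.max (x + y - 1) 0.

Definition unit_vec (p : nat) (x : 'cV[R]_p) : Prop :=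
  forall j, 0 <= x j 0 <= 1.

Definition le_vec (p : nat) (x y : 'cV[R]_p) : Prop :=
  forall j, x j 0 <= y j 0.

(* In the iterated max and min below the default value never affects the
   result when m, n > 0 and the data lie in [0, 1]: the values of TL and
   xcheck are at least 0, those of xhat are at most 1. *)

Definition feasible : set 'cV[R]_n :=
  [set x | unit_vec x /\
     forall i, \big[Num.max/0]_(j < n) TL (A i j) (x j 0) = b i 0]%classic.

Definition minimal_solutions : set 'cV[R]_n :=
  [set x | feasible x /\
     forall y, feasible y -> le_vec y x -> y = x]%classic.

Definition J (i : 'I_m) : {set 'I_n} := [set j | b i 0 <= A i j]%SET.

(* A choice function into the union of the J i is encoded as a function
   into the whole index set 'I_n with e i in J i; similarly for Ebar. *)
Definition E : set ('I_m -> 'I_n) := [set e | forall i, e i \in J i]%classic.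

Definition xhat (i : 'I_m) : 'cV[R]_n :=
  \col_j (if j \in J i then b i 0 + 1 - A i j else 1).

Definition Xbar : 'cV[R]_n := \col_j \big[Num.min/1]_(i < m) xhat i j 0.

Definition Jbar (i : 'I_m) : {set 'I_n} :=
  [set j in J i | TL (A i j) (Xbar j 0) == b i 0]%SET.

Definition Ebar : set ('I_m -> 'I_n) :=
  [set e | forall i, e i \in Jbar i]%classic.

(* Only meaningful for j in J i. *)
Definition xcheck (i : 'I_m) (j : 'I_n) : 'cV[R]_n :=
  \col_k (if (b i 0 != 0) && (k == j) then b i 0 + 1 - A i j else 0).

Definition Xlow (e : 'I_m -> 'I_n) : 'cV[R]_n :=
  \col_j \big[Num.max/0]_(i < m) xcheck i (e i) j 0.

End LukasiewiczSystem.

(* Main.v *)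
(* In a minimal solution x, each row i attains its maximum at some column e i.
   Every solution lies below Xbar, so e i is in Jbar i; and Xlow e is itself
   a solution below x, so it equals x by minimality. *)
Require Import Defs.
From HB Require Import structures.
From mathcomp Require Import all_boot all_order all_algebra.
From mathcomp Require Import classical_sets lra.

Set Implicit Arguments.
Unset Strict Implicit.
Unset Printing Implicit Defensive.

Import Order.TTheory GRing.Theory Num.Theory.

Local Open Scope classical_set_scope.
Local Open Scope ring_scope.

Lemma TL_mono (R : realFieldType) (a x y : R) : x <= y -> TL a x <= TL a y.
Proof. by move=> xy; rewrite /TL le_max2 // lerB // lerD. Qed.

(** Residuation of the t-norm: for [c >= 0] the truncation at 0 in [TL] does not affect the
    bound. *)
Lemma TL_le (R : realFieldType) (a x c : R) :
  0 <= c -> (TL a x <= c) = (x <= c + 1 - a).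
Proof. by move=> c0; rewrite /TL ge_max c0 andbT; apply/idP/idP; lra. Qed.

(** Here [c] must be positive: at [c = 0] the left side always holds, because [TL] is truncated at
    0. *)
Lemma TL_ge (R : realFieldType) (a x c : R) :
  0 < c -> (c <= TL a x) = (c + 1 - a <= x).
Proof.
move=> c0; rewrite /TL le_max (leNgt c 0) c0 orbF.
by apply/idP/idP; lra.
Qed.

Section Solutions.

Variables (R : realFieldType) (m n : nat) (A : 'M[R]_(m, n)) (b : 'cV[R]_m).
Hypotheses (A01 : forall i j, 0 <= A i j <= 1) (b01 : unit_vec b).

Lemma feasible_TL_le (x : 'cV[R]_n) i j :
  feasible A b x -> TL (A i j) (x j 0) <= b i 0.
Proof. by case=> _ <-; exact: le_bigmax. Qed.

Lemma feasible_attained (x : 'cV[R]_n) i :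
  (0 < n)%N -> feasible A b x -> exists j, TL (A i j) (x j 0) = b i 0.
Proof.
move=> n_gt0 [_ /(_ i) <-].
rewrite (@bigmax_eq_arg _ _ _ _ (Ordinal n_gt0)) //; first by eexists.
by move=> j _; rewrite /TL le_max lexx orbT.
Qed.

(** By residuation, row [i] bounds [x j 0] by [b i 0 + 1 - A i j], which is the entry of [xhat i]
    when [j] is in [J i]. *)
Lemma feasible_le_Xbar (x : 'cV[R]_n) : feasible A b x -> le_vec x (Xbar A b).
Proof.
move=> fx j; rewrite mxE; case: (fx) => /(_ j)/andP[_ xj1] _.
apply: le_bigmin => // i _; rewrite mxE; case: ifP => // _.
by rewrite -TL_le ?feasible_TL_le //; case/andP: (b01 i).
Qed.

Lemma Jbar_attained (x : 'cV[R]_n) i j :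
  feasible A b x -> TL (A i j) (x j 0) = b i 0 -> j \in Jbar A b i.
Proof.
move=> fx xij; have /andP[b0 _] := b01 i.
have jJ : j \in J A b i.
  (* Since [x j 0 <= 1], the value [TL (A i j) (x j 0)], which is [b i 0], is at most [A i j]. *)
  rewrite inE -xij TL_le; last by case/andP: (A01 i j).
  by case: fx => /(_ j)/andP[_ xj1] _; lra.
(* Monotonicity from [x] up to [Xbar] gives [>=]; what remains is [<=], from [Xbar] lying below
   [xhat i]. *)
rewrite inE jJ eq_le TL_le // -{2}xij TL_mono ?feasible_le_Xbar // andbT.
apply: le_trans (_ : xhat A b i j 0 <= _); first by rewrite mxE bigmin_le.
by rewrite mxE jJ.
Qed.

Lemma Xlow_le (x : 'cV[R]_n) e : unit_vec x ->
  (forall i, TL (A i (e i)) (x (e i) 0) = b i 0) -> le_vec (Xlow A b e) x.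
Proof.
move=> x01 xe j; have /andP[x0 _] := x01 j.
rewrite mxE; apply: bigmax_le => // i _; rewrite mxE.
case: ifP => // /andP[bi0 /eqP->].
by rewrite -TL_ge ?xe // lt0r bi0; case/andP: (b01 i).
Qed.

Lemma Xlow_feasible (x : 'cV[R]_n) e : feasible A b x ->
  (forall i, TL (A i (e i)) (x (e i) 0) = b i 0) -> feasible A b (Xlow A b e).
Proof.
move=> fx xe; have [x01 _] := fx; have lex := Xlow_le x01 xe; split=> [j|i].
  rewrite (le_trans (lex j)) ?andbT; last by case/andP: (x01 j).
  by rewrite mxE bigmax_ge_id.
have /andP[b0 _] := b01 i; apply/le_anti/andP; split.
  apply: bigmax_le => // j _.
  exact: le_trans (TL_mono _ (lex j)) (feasible_TL_le _ _ fx).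
(* If [b i 0 = 0], [xcheck i] vanishes and the default 0 of the maximum suffices. Otherwise column
   [e i] reaches [b i 0], since [Xlow] there is at least the entry of [xcheck i (e i)]. *)
have [->|bi0] := eqVneq (b i 0) 0; first exact: bigmax_ge_id.
apply: (bigmax_sup (e i)) => //; rewrite TL_ge ?lt0r ?bi0 // mxE.
by apply: (bigmax_sup i) => //; rewrite mxE bi0 eqxx.
Qed.

End Solutions.

Theorem corollary3 (R : realFieldType) (m n : nat) (A : 'M[R]_(m, n))
    (b : 'cV[R]_m) (m_gt0 : (0 < m)%N) (n_gt0 : (0 < n)%N)
    (A01 : forall i j, 0 <= A i j <= 1) (b01 : unit_vec b) :
  minimal_solutions A b `<=` [set Xlow A b e | e in Ebar A b] /\
  [set Xlow A b e | e in Ebar A b] `<=` [set Xlow A b e | e in E A b].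
Proof.
split=> [x [fx xmin]|_ [e eJ <-]]; last first.
  by exists e => // i; have := eJ i; rewrite inE => /andP[].
have [e xe] := fin_all_exists (fun i => feasible_attained i n_gt0 fx).
exists e; first by move=> i; exact: Jbar_attained (xe i).
apply: xmin; first exact: Xlow_feasible fx xe.
by case: fx => x01 _; exact: Xlow_le.
Qed.
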